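(* Let $X$ be a Banach space and $T:X\rightrightarrows X^*$ a regular maximal monotone multifunction. For $\varepsilon\ge 0$ and $x\in X$ let $$T^\varepsilon(x)=\{x^*\in X^*: \langle x^*-y^*,x-y\rangle\ge-\varepsilon\|x-y\|\ \text{ for all }(y,y^* )\in G(T)\}.$$ Let $x\in X$, $\varepsilon\ge 0$ and $x^*\in T^\varepsilon(x)$. Then: (a) $x\in D_T$. (b) $T^\varepsilon(x)=T(x)+\varepsilon B^*$. (c) The enlargement $\{T^\varepsilon\}_{\varepsilon\ge 0}$ satisfies the following monotonicity property: for all $\varepsilon,\delta\ge 0$, all $x,y\in X$, all $x^*\in T^\varepsilon(x)$ and all $y^*\in T^\delta(y)$, $$\langle x^*-y^*,x-y\rangle\ge-(\varepsilon+\delta)\|x-y\|.$$ (d) The enlargement $\{T^\varepsilon\}_{\varepsilon\ge 0}$ is maximal in the following sense: for every $\varepsilon\ge 0$ and $(x,x^* )\in X\times X^*$, if $$\langle x^*-y^*,x-y\rangle\ge-(\varepsilon+\delta)\|x-y\|\quad\text{for all }\delta\ge 0,\ y\in X\text{ and }y^*\in T^\delta(y),$$ then $x^*\in T^\varepsilon(x)$.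
   Context: $X$ is a (real) Banach space with topological dual $X^*$, $B^*$ is the (closed) unit ball of $X^*$, and $\langle x^*,x\rangle=\langle x,x^*\rangle$ denotes the evaluation pairing. For a multifunction $T:X\rightrightarrows X^*$, its graph is $G(T)=\{(x,x^* )\in X\times X^*: x^*\in T(x)\}$ and its domain is $D_T=\{x\in X: T(x)\neq\emptyset\}$. $T$ is monotone if $\langle x^*-y^*,x-y\rangle\ge 0$ for all $(x,x^* ),(y,y^* )\in G(T)$; it is maximal monotone if it is monotone and there is no monotone multifunction $S:X\rightrightarrows X^*$ whose graph strictly contains $G(T)$. An enlargement of $T$ is a multifunction $E:[0,\infty)\times X\rightrightarrows X^*$ such that $T(x)\subseteq E(\varepsilon,x)$ for every $x\in X$ and every $\varepsilon\ge 0$. For $(x,x^* )\in X\times X^*$ put $$L(x,x^*,T)=\max\left\{0,\ \sup\left\{\frac{\langle x^*-y^*,y-x\rangle}{\|x-y\|}: (y,y^* )\in G(T),\ y\neq x\right\}\right\}\in[0,\infty],$$ and $d(x^*,T(x))=\inf\{\|y^*-x^*\|: y^*\in T(x)\}$, with $d(x^*,\emptyset)=\infty$. A maximal monotone multifunction $T$ is called regular if $L(x,x^*,T)=d(x^*,T(x))$ for every $(x,x^* )\in X\times X^*$. *)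

(* Defs.v *)
From HB Require Import structures.
From mathcomp Require Import all_boot all_order all_algebra.
From mathcomp Require Import mathcomp_extra boolp classical_sets functions reals.
From mathcomp Require Import constructive_ereal ereal topology normedtype.

Set Implicit Arguments.
Unset Strict Implicit.
Unset Printing Implicit Defensive.

Import Order.TTheory GRing.Theory Num.Theory.
Import numFieldNormedType.Exports.

Local Open Scope classical_set_scope.
Local Open Scope ring_scope.

(* Topological dual: the continuous linear functionals, as a submodule of the
   space of all functions X -> R, made into a normed module by the operator
   norm. *)
Section dual.
Context {R : realType} {X : normedModType R}.

Definition dual_pred : {pred X -> R^o} :=
  fun f => `[< linear f /\ continuous f >].

Lemma dual_submod_closed : submod_closed dual_pred.
Proof.
split=> [|a f g /asboolP[lf cf] /asboolP[lg cg]].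
  apply/asboolP; split=> [a u v|x]; last exact: cvg_cst.
  by change (0 = a *: 0 + 0 :> R^o); rewrite scaler0 addr0.
apply/asboolP; split=> [b u v|x].
  change (a *: f (b *: u + v) + g (b *: u + v) =
    b *: (a *: f u + g u) + (a *: f v + g v)).
  by rewrite lf lg !scalerDr !scalerA (mulrC a b) addrACA.
by apply: cvgD (cg x); apply: cvgZ (cf x); exact: cvg_cst.
Qed.

HB.instance Definition _ := GRing.isSubmodClosed.Build _ _ dual_pred
  dual_submod_closed.

End dual.

Record dual (R : realType) (X : normedModType R) := Dual {
  dual_fun :> X -> R^o ;
  dual_funP : dual_fun \in dual_pred }.

Section dual_lmodule.
Context {R : realType} {X : normedModType R}.

HB.instance Definition _ := [isSub for @dual_fun R X].
HB.instance Definition _ := [Choice of dual X by <:].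
HB.instance Definition _ := [SubChoice_isSubLmodule of dual X by <:].

Lemma dual_linear (f : dual X) : linear f.
Proof. by case: f => f /= /asboolP[]. Qed.

Lemma dual_continuous (f : dual X) : continuous f.
Proof. by case: f => f /= /asboolP[]. Qed.

HB.instance Definition _ (f : dual X) :=
  GRing.isLinear.Build R X R^o *:%R f (dual_linear f).

Lemma dual_ext (f g : dual X) : (forall x, f x = g x) -> f = g.
Proof. by move=> fg; apply/val_inj/funext. Qed.

Lemma dualDE (f g : dual X) x : (f + g) x = f x + g x. Proof. by []. Qed.
Lemma dualNE (f : dual X) x : (- f) x = - f x. Proof. by []. Qed.
Lemma dualBE (f g : dual X) x : (f - g) x = f x - g x. Proof. by []. Qed.
Lemma dualZE a (f : dual X) x : (a *: f) x = a * f x. Proof. by []. Qed.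
Lemma dual0E x : (0 : dual X) x = 0. Proof. by []. Qed.

Definition dual_norm (f : dual X) : R :=
  sup [set `|f x| | x in [set x : X | `|x| <= 1]].

Lemma dual_norm_has_sup (f : dual X) :
  has_sup [set `|f x| | x in [set x : X | `|x| <= 1]].
Proof.
split; first by exists `|f 0|, 0 => //=; rewrite normr0.
have /continuous_linear_bounded/bounded_funP/(_ 1)[M fM] :
  {for 0, continuous f} by exact: dual_continuous.
by exists M => _ [x /= x1 <-]; exact: fM.
Qed.

Lemma dual_norm_ub (f : dual X) x : `|x| <= 1 -> `|f x| <= dual_norm f.
Proof.
by move=> x1; apply: ub_le_sup; [case: (dual_norm_has_sup f)|exists x].
Qed.

Lemma dual_norm_le (f : dual X) M :
  (forall x, `|x| <= 1 -> `|f x| <= M) -> dual_norm f <= M.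
Proof.
move=> fM; apply: ge_sup; first by case: (dual_norm_has_sup f).
by move=> _ [x /= x1 <-]; exact: fM.
Qed.

Lemma dual_norm_ge0 (f : dual X) : 0 <= dual_norm f.
Proof. by apply: le_trans (@dual_norm_ub f 0 _); rewrite ?normr0. Qed.

Lemma dual_normP (f : dual X) x : `|f x| <= dual_norm f * `|x|.
Proof.
have [->|x0] := eqVneq x 0; first by rewrite linear0 !normr0 mulr0.
have nx : 0 < `|x| by rewrite normr_gt0.
have := @dual_norm_ub f (`|x|^-1 *: x) _.
rewrite linearZ /= !normrZ normfV normr_id mulVf ?gt_eqF// => /(_ (lexx _)).
by rewrite ler_pdivrMl// mulrC.
Qed.

Lemma dual_normD (f g : dual X) :
  dual_norm (f + g) <= dual_norm f + dual_norm g.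
Proof.
apply: dual_norm_le => x x1; rewrite dualDE.
by apply: le_trans (ler_normD _ _) _; rewrite lerD ?dual_norm_ub.
Qed.

Lemma dual_normZ a (f : dual X) : dual_norm (a *: f) = `|a| * dual_norm f.
Proof.
have le b (g : dual X) : dual_norm (b *: g) <= `|b| * dual_norm g.
  apply: dual_norm_le => x x1.
  by rewrite dualZE normrM ler_wpM2l ?dual_norm_ub.
apply/eqP; rewrite eq_le le/=; have [->|a0] := eqVneq a 0.
  by rewrite normr0 mul0r dual_norm_ge0.
have := le a^-1 (a *: f); rewrite scalerA mulVf// scale1r normfV.
by rewrite ler_pdivlMl ?normr_gt0.
Qed.

Lemma dual_norm_eq0 (f : dual X) : dual_norm f = 0 -> f = 0.
Proof.
move=> f0; apply: dual_ext => x; apply/eqP; rewrite dual0E -normr_le0.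
by have := dual_normP f x; rewrite f0 mul0r.
Qed.

HB.instance Definition _ :=
  Lmodule_isNormed.Build R (dual X) dual_normD dual_normZ dual_norm_eq0.

Lemma dual_normE (f : dual X) : `|f| = dual_norm f. Proof. by []. Qed.

End dual_lmodule.

Section multifunctions.
Context {R : realType} {X : normedModType R}.
Implicit Types (T S : X -> set (dual X)) (E : R -> X -> set (dual X)).

Definition dual_ball : set (dual X) := [set b | `|b| <= 1].

Definition graph T : set (X * dual X) := [set p | T p.1 p.2].

Definition domain T : set X := [set x | T x !=set0].

Definition monotone T := forall x x' y y',
  graph T (x, x') -> graph T (y, y') -> 0 <= (x' - y') (x - y).

Definition maximal_monotone T :=
  monotone T /\ ~ exists S, monotone S /\ graph T `<` graph S.

(* Only the values of E at nonnegative reals are meaningful. *)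
Definition is_enlargement T E := forall eps x, 0 <= eps -> T x `<=` E eps x.

(* The supremum of the empty set is -oo, so that then monL x x' T = 0. *)
Definition monL (x : X) (x' : dual X) T : \bar R :=
  maxe 0%E (ereal_sup [set ((x' - p.2) (p.1 - x) / `|x - p.1|)%:E
                      | p in graph T `&` [set p | p.1 <> x]]).

(* The infimum of the empty set is +oo. *)
Definition dist_dual (x' : dual X) (A : set (dual X)) : \bar R :=
  ereal_inf [set `|y' - x'|%:E | y' in A].

Definition regular T :=
  maximal_monotone T /\ forall x x', monL x x' T = dist_dual x' (T x).

Definition enlarge T (eps : R) (x : X) : set (dual X) :=
  [set x' | forall y y', graph T (y, y') ->
    - eps * `|x - y| <= (x' - y') (x - y)].

Lemma enlarge_is_enlargement T : monotone T -> is_enlargement T (enlarge T).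
Proof.
move=> mT eps x eps0 x' Tx y y' Ty; apply: (@le_trans _ _ 0); last exact: mT.
by rewrite mulNr oppr_le0 mulr_ge0.
Qed.

End multifunctions.

(* Main.v *)
From HB Require Import structures.
Require Import Defs.
From mathcomp Require Import all_boot all_order all_algebra.
From mathcomp Require Import mathcomp_extra boolp classical_sets functions reals.
From mathcomp Require Import constructive_ereal ereal topology normedtype.

Import Order.TTheory GRing.Theory Num.Theory.
Import numFieldNormedType.Exports.

Local Open Scope classical_set_scope.
Local Open Scope ring_scope.

(* The only part needing more than a computation is [T^eps(x) `<=` T(x) + eps B].
   Every [x' \in T^eps(x)] has [L(x, x', T) <= eps], so by regularity its distance
   to [T(x)] is at most eps. This distance is attained: [T(x)] is weak* closed by
   maximality, so any weak* limit along an ultrafilter of points of [T(x)] at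
   distance at most [eps + e], as e tends to [0^'+], realizes it. *)

(** By compactness of [[-M, M]] the image ultrafilter has a cluster point, and a cluster point of an
    ultrafilter is a limit. *)
Lemma ultra_bounded_cvg (R : realType) (I : Type) (U : set_system I)
    (f : I -> R) (M : R) :
  UltraFilter U -> (\forall i \near U, `|f i| <= M) ->
  exists l : R, f i @[i --> U] --> l.
Proof.
move=> ultraU fM.
have [|l [_ cl]] := @segment_compact R (- M) M (f @ U) _.
  by near do rewrite /= in_itv /= -ler_norml.
exists l => V /= Vl.
have [//|UnV] := in_ultra_setVsetC (f @^-1` V) ultraU.
by have [r []] := cl (~` V) V UnV Vl.
Unshelve. all: by end_near. Qed.

(* The Banach-Alaoglu theorem, in the form: an ultrafilter on a bounded family
   of functionals has a weak* limit. *)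
Lemma dual_ultra_cvg (R : realType) (X : normedModType R) (I : Type)
    (U : set_system I) (u : I -> dual X) (M : R) :
  UltraFilter U -> (\forall i \near U, `|u i| <= M) ->
  exists v : dual X, forall x, (u i x : R) @[i --> U] --> (v x : R).
Proof.
move=> ultraU uM.
have ux x : \forall i \near U, `|(u i x : R)| <= M * `|x|.
  near=> i; apply: le_trans (dual_normP (u i) x) _.
  by rewrite ler_wpM2r// -dual_normE; near: i.
(* The weak* limit is built pointwise; linearity and the bound [M] pass to the limit. *)
have /choice[g ug] x : exists l : R, (u i x : R) @[i --> U] --> l.
  exact: ultra_bounded_cvg (ux x).
have lin_g : linear (g : X -> R^o).
  move=> a x y; apply: (@cvg_unique _ (@norm_hausdorff _ R) _ _ _ _ (ug _)).
  have -> : (fun i => u i (a *: x + y) : R) = (fun i => a * u i x + u i y).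
    by apply/funext => i; exact: dual_linear.
  by apply: cvgD => //; apply: cvgM => //; exact: cvg_cst.
pose gl : {linear X -> R^o} :=
    HB.pack g (GRing.isLinear.Build R X R^o *:%R g lin_g).
have gM x : `|g x| <= M * `|x|.
  exact: cvgr_to_le (cvg_norm (ug x)) (ux x).
have cont_g : continuous (g : X -> R^o).
  apply: (@bounded_linear_continuous _ _ _ gl); apply/linear_boundedP.
  near=> r => x; apply: le_trans (gM x) _; apply: ler_wpM2r => //.
  by near: r; apply: nbhs_pinfty_ge; exact: num_real.
have gP : (g : X -> R^o) \in dual_pred by apply/asboolP.
by exists (Dual gP).
Unshelve. all: by end_near. Qed.

Section multifunctions.
Context {R : realType} {X : normedModType R}.
Implicit Types (T : X -> set (dual X)).

(** A point of [enlarge T 0 x] can be adjoined to the graph without losing monotonicity, so by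
    maximality it is already there. This exhibits [T x] as an intersection of weak* closed
    half-spaces. *)
Lemma maximal_monotoneE T x : maximal_monotone T -> T x = enlarge T 0 x.
Proof.
move=> [mT maxT]; apply/seteqP; split => x' Tx.
  exact: enlarge_is_enlargement.
apply: contrapT => nTx; apply: maxT.
exists (fun z => T z `|` [set z' | (z, z') = (x, x')]); split.
  have Tx0 y y' : graph T (y, y') -> 0 <= (x' - y') (x - y).
    by move=> /Tx; rewrite oppr0 mul0r.
  move=> y y' z z' [Ty|[-> ->]] [Tz|[-> ->]].
  - exact: mT.
  - by rewrite -(opprB x') -(opprB x) dualNE linearN opprK; exact: Tx0.
  - exact: Tx0.
  - by rewrite (subrr x') dual0E.
split=> [[z z'] Tz|]; first by left.
by move=> /(_ (x, x')); apply: contra_not nTx; apply; right.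
Qed.

Lemma regular_dist_le T eps x x' : regular T -> 0 <= eps ->
  enlarge T eps x x' -> (dist_dual x' (T x) <= eps%:E)%E.
Proof.
move=> [_ <-] eps0 Ex; rewrite /monL ge_max lee_fin eps0 andTb.
apply: ge_ereal_sup => _ [p [Tp px] <-]; rewrite lee_fin.
have xp : 0 < `|x - p.1| by rewrite normr_gt0 subr_eq0; apply/eqP => /esym.
rewrite ler_pdivrMr// -(opprB x) linearN lerNl -mulNr.
exact: Ex.
Qed.

Lemma enlarge_dist_attained T delta x x' eps :
  (dist_dual x' (enlarge T delta x) <= eps%:E)%E ->
  exists2 u, enlarge T delta x u & `|x' - u| <= eps.
Proof.
move=> dle.
(* [u e] is a minimizer up to [e]; its values at [e <= 0] are irrelevant, since the ultrafilter [U]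
   below contains the positive reals. *)
have /choice[u uP] (e : R) : exists v : dual X, 0 < e ->
    enlarge T delta x v /\ `|v - x'| <= eps + e.
  have [e0|//] := ltP 0 e; last by exists 0.
  have /ereal_inf_lt[_ [v Ev <-]] :
      (dist_dual x' (enlarge T delta x) < (eps + e)%:E)%E.
    by apply: le_lt_trans dle _; rewrite lte_fin ltrDl.
  by rewrite lte_fin => /ltW vle; exists v.
have [U [ultraU subU]] := @ultraFilterLemma _ (0^'+ : set_system R) _.
have nearU e : 0 < e -> \forall d \near U, 0 < d /\ d <= e.
  move=> e0; apply: subU; near=> d; split=> //.
  by near: d; exact: nbhs_right_le.
(* The bound is the triangle inequality through [x'], for [d <= 1]. *)
have [|v uv] := @dual_ultra_cvg R X _ U u (`|x'| + (eps + 1)) ultraU.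
  near=> d.
  have [d0 d1] : 0 < d /\ d <= 1 by near: d; exact: nearU.
  rewrite -(subrK x' (u d)) addrC; apply: le_trans (ler_normD _ _) _.
  by rewrite lerD2l (le_trans (uP d d0).2)// lerD2l.
exists v => [y y' Ty|].
  rewrite dualBE lerBrDr.
  apply: cvgr_to_ge (uv (x - y)) _.
  near=> d; rewrite /= -lerBrDr -dualBE; apply: (uP d _).1 => //.
  by near: d; apply: filterS (nearU 1 ltr01) => d [].
(* Weak* lower semicontinuity of the norm: bounds at each point of the unit ball survive the
   limit. *)
rewrite distrC dual_normE.
apply/ler_addgt0Pr => e e0; apply: dual_norm_le => z z1.
have uz : ((u d - x') z : R) @[d --> U] --> ((v - x') z : R).
  exact: cvgB (uv z) (cvg_cst (x' z : R)).
apply: cvgr_to_le (cvg_norm uz) _; near=> d.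
have [d0 de] : 0 < d /\ d <= e by near: d; exact: nearU.
apply: le_trans (dual_norm_ub (u d - x') z1) _; rewrite -dual_normE.
by apply: le_trans (uP d d0).2 _; rewrite lerD2l.
Unshelve. all: by end_near. Qed.

Lemma regular_enlargeE T eps x : regular T -> 0 <= eps ->
  enlarge T eps x = [set u + eps *: b | u in T x & b in dual_ball].
Proof.
move=> rT eps0; have [mT _] := rT.
apply/seteqP; split => [x' /(regular_dist_le _ _ _ _ rT eps0)|_ [u Tu [b b1] <-] y y' Ty].
  (* With [u] a point of [T x] within [eps] of [x'], the ball element is [(x' - u) / eps]; if
     [eps = 0], then [x' = u]. *)
  rewrite (maximal_monotoneE _ x mT) => /enlarge_dist_attained[u Tu ule].
  exists u => //; have [e0|e0] := eqVneq eps 0.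
    exists 0; first by rewrite /dual_ball /= normr0.
    rewrite scaler0 addr0; apply/esym/eqP; rewrite -subr_eq0 -normr_le0.
    by rewrite -e0.
  exists (eps^-1 *: (x' - u)); last by rewrite scalerA divff// scale1r addrC subrK.
  rewrite /dual_ball /= normrZ ger0_norm ?invr_ge0//.
  by rewrite ler_pdivrMl ?mulr1// lt_def e0.
(* Monotonicity makes the [u] part nonnegative; [eps *: b] costs at most [eps * |x - y|]. *)
rewrite addrAC dualDE dualZE mulNr -[leLHS]add0r lerD//; first exact: mT.1.
rewrite -mulrN ler_wpM2l//.
suff /ler_normlP[]: `|b (x - y)| <= `|x - y| by rewrite lerNl.
apply: le_trans (dual_normP _ _) _.
by rewrite -[leRHS]mul1r ler_wpM2r// -dual_normE.
Qed.

(** Only [y'] needs decomposing, as [v + delta *: c] with [v] in [T y]: testing [x'] against [v]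
    costs [eps], and [delta *: c] costs [delta]. *)
Lemma regular_enlarge_monotone T eps delta x y x' y' : regular T ->
  0 <= eps -> 0 <= delta -> enlarge T eps x x' -> enlarge T delta y y' ->
  - (eps + delta) * `|x - y| <= (x' - y') (x - y).
Proof.
move=> rT eps0 delta0 Ex; rewrite regular_enlargeE// => -[v Tv [c c1] <-].
rewrite (opprD v) addrA dualDE opprD mulrDl lerD//; first exact: Ex.
rewrite dualNE dualZE mulNr lerN2 ler_wpM2l//.
apply: le_trans (ler_norm _) _; apply: le_trans (dual_normP _ _) _.
by rewrite -[leRHS]mul1r ler_wpM2r// -dual_normE.
Qed.

End multifunctions.

Theorem theorem7 (R : realType) (X : completeNormedModType R)
    (T : X -> set (dual X)) (hT : regular T)
    (x : X) (eps : R) (heps : 0 <= eps) (x' : dual X)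
    (hx' : enlarge T eps x x') :
  [/\ domain T x,
      enlarge T eps x = [set u + eps *: b | u in T x & b in dual_ball],
      (forall (eps delta : R) (x y : X) (x' y' : dual X),
          0 <= eps -> 0 <= delta ->
          enlarge T eps x x' -> enlarge T delta y y' ->
          - (eps + delta) * `|x - y| <= (x' - y') (x - y)) &
      (forall (eps : R) (x : X) (x' : dual X), 0 <= eps ->
          (forall (delta : R) (y : X) (y' : dual X), 0 <= delta ->
              enlarge T delta y y' ->
              - (eps + delta) * `|x - y| <= (x' - y') (x - y)) ->
          enlarge T eps x x')].
Proof.
split.
(* An empty [T x] would be at distance [+oo], not at most [eps]. *)
- have dle := regular_dist_le _ _ _ _ hT heps hx'.
  apply: contrapT => /nonemptyPn T0; move: dle.
  by rewrite /dist_dual T0 image_set0 ereal_inf0.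
- exact: regular_enlargeE.
- by move=> *; exact: (regular_enlarge_monotone T).
(* The case [delta = 0] suffices, since [T y] lies in [enlarge T 0 y]. *)
- move=> e z z' e0 mz y y' Ty; rewrite -[e]addr0; apply: mz => //.
  exact: enlarge_is_enlargement hT.1.1 _ _ (lexx 0) _ Ty.
Qed.
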